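(* Let $Q\in\mathbb{R}^{n\times n}$ be symmetric positive definite with half-bandwidth at most $\nu$, where $0\le\nu\le n-1$, let $r\in\mathbb{R}^n$, and consider the energy $W_r$ and the layered trellis defined in the context. Let $z^{(1)},\ldots,z^{(2^n)}$ be the permutation of $\{0,1\}^n$ with $W_r(z^{(1)})\le\cdots\le W_r(z^{(2^n)})$, with equal-energy patterns ordered by a fixed deterministic tie-breaking policy (the LP-GRAND ordering). Suppose that an enumerator emits the distinct length-$n$ trellis paths beginning at the initial state in nondecreasing total path cost, using that same deterministic tie-breaking policy. Then, for every $1\le K\le2^n$, the branch-label sequences of the first $K$ emitted paths are the first $K$ noise-effect patterns $z^{(1)},\ldots,z^{(K)}$ in the LP-GRAND ordering, and their induced words $y\oplus z^{(1)},\ldots,y\oplus z^{(K)}$ are the first $K$ candidate queries. The trellis has at most $2^\nu$ states per layer, at most $(n+1)2^\nu$ states across all layers, and at most $n2^{\nu+1}$ branches. Consequently, for fixed $\nu$, both the number of states and the number of branches grow linearly with $n$.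
   Context: $\oplus$ is componentwise addition over $\mathbb{F}_2$. For $c\in\{0,1\}^n$, $x(c)=(1-2c_1,\ldots,1-2c_n)^{\mathsf T}$. For $r\in\mathbb{R}^n$: $y_i=0$ if $r_i\ge0$ and $y_i=1$ otherwise; $s=x(y)$; $a=r-s$; and for $z\in\{0,1\}^n$, $$W_r(z)=\sum_{i=1}^n\alpha_iz_i+\sum_{1\le i<j\le n}\beta_{ij}z_iz_j,\qquad \alpha_i=2s_i(Qa)_i+2Q_{ii},\quad \beta_{ij}=4s_is_jQ_{ij}.$$ A symmetric matrix $Q$ has half-bandwidth at most $\nu$ if $Q_{ij}=0$ whenever $|i-j|>\nu$. The candidate query with index $q$ is the word $y\oplus z^{(q)}$. A deterministic tie-breaking policy is a fixed total ordering of the patterns within each equal-energy class; applied to paths, it orders equal-cost paths through their branch-label sequences. Trellis: there are $n+1$ state layers, each with state space $\{0,1\}^\nu$ if $\nu\ge1$ and $\{\varnothing\}$ if $\nu=0$. At each layer $i=1,\ldots,n$, from each state $u$ there is a branch for each label $b\in\{0,1\}$, leading to the successor state $T(u,b)$ in the next layer and having cost $\gamma_i(u,b)$. For $\nu\ge1$ and $u=(u_1,\ldots,u_\nu)$, $$\gamma_i(u,b)=\alpha_ib+\sum_{d=1}^{\min\{\nu,i-1\}}\beta_{i-d,i}\,u_{\nu-d+1}\,b,$$ $T(u,b)=(b)$ if $\nu=1$, and $T(u,b)=(u_2,\ldots,u_\nu,b)$ if $\nu\ge2$. For $\nu=0$, $\gamma_i(\varnothing,b)=\alpha_ib$ and $T(\varnothing,b)=\varnothing$.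 The initial state is $(0,\ldots,0)$ for $\nu\ge1$ and $\varnothing$ for $\nu=0$. The cost of a length-$n$ path is the sum of its $n$ branch costs. *)

(* Defs.v *)
From mathcomp Require Export all_boot all_order all_algebra.
From mathcomp Require Export boolp classical_sets reals topology normedtype landau.
Export Order.TTheory GRing.Theory Num.Theory numFieldNormedType.Exports.

Set Implicit Arguments.
Unset Strict Implicit.
Unset Printing Implicit Defensive.

Local Open Scope ring_scope.

(* Words of {0,1}^n are Boolean tuples; 1-based indices of the mathematical
   text are shifted to 0-based ordinals throughout. *)

Definition word_add n (c d : n.-tuple bool) : n.-tuple bool :=
  [tuple tnth c i (+) tnth d i | i < n].

Definition posdefmx (R : realType) n (Q : 'M[R]_n) : Prop :=
  Q^T = Q /\ forall v : 'cV[R]_n, v != 0 -> 0 < (v^T *m Q *m v) 0 0.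

(* The distance |i - j| is written with truncated subtractions. *)
Definition half_bandwidth_le (R : realType) n (nu : nat) (Q : 'M[R]_n) : Prop :=
  forall i j : 'I_n, (nu < (i - j) + (j - i))%N -> Q i j = 0.

Section Energy.
Variables (R : realType) (n : nat) (Q : 'M[R]_n) (r : 'cV[R]_n).

Definition bpsk (c : n.-tuple bool) : 'cV[R]_n :=
  \col_i (1 - 2 * (tnth c i)%:R).

Definition hard_decision : n.-tuple bool := [tuple r i 0 < 0 | i < n].

Let s := bpsk hard_decision.
Let a := r - s.

Definition alpha (i : 'I_n) : R := 2 * s i 0 * (Q *m a) i 0 + 2 * Q i i.

Definition beta (i j : 'I_n) : R := 4 * s i 0 * s j 0 * Q i j.

Definition energy (z : n.-tuple bool) : R :=
  \sum_i alpha i * (tnth z i)%:R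
  + \sum_(i < n) \sum_(j < n | (i < j)%N) beta i j * (tnth z i)%:R * (tnth z j)%:R.

Definition candidate_queries (zs : seq (n.-tuple bool)) : seq (n.-tuple bool) :=
  [seq word_add hard_decision z | z <- zs].

End Energy.

Section Ordering.
Variables (R : realType) (n : nat).

(* [tie] is constrained only inside each equal-energy class. *)
Definition tie_policy (W : n.-tuple bool -> R) (tie : rel (n.-tuple bool)) :=
  forall w : R, let C := [pred z | W z == w] in
  [/\ {in C, reflexive tie}, {in C &, antisymmetric tie},
      {in C & &, transitive tie} & {in C &, total tie}].

(* Objects of nondecreasing cost, those of equal cost being ordered by the
   policy applied to their bit patterns [key]. *)
Definition ranked (T : Type) (cost : T -> R) (key : T -> n.-tuple bool)
    (tie : rel (n.-tuple bool)) (ts : seq T) : bool :=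
  pairwise (fun t u => (cost t < cost u)
                       || (cost t == cost u) && tie (key t) (key u)) ts.

Definition lpgrand_order (W : n.-tuple bool -> R) (tie : rel (n.-tuple bool))
    (zs : seq (n.-tuple bool)) : Prop :=
  perm_eq zs (enum {: n.-tuple bool}) /\ ranked W id tie zs.

End Ordering.

(* State (u_1, ..., u_nu) is the tuple u with u_k = nth false u k.-1; for nu = 0
   the only state is the empty tuple. *)
Notation state nu := (nu.-tuple bool) (only parsing).

(* rcons then behead gives (u_2, ..., u_nu, b) for nu >= 2, (b) for nu = 1, and
   the empty tuple for nu = 0. *)
Definition next_state nu (u : state nu) (b : bool) : state nu :=
  [tuple of behead (rcons u b)].

(* A node is a state together with its layer, among n + 1. *)
Definition node (n nu : nat) := ('I_n.+1 * state nu)%type.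

(* A branch is given by its layer, its source state and its label; the label
   keeps apart the two parallel branches of each layer when nu = 0. *)
Definition branch (n nu : nat) := ('I_n * state nu * bool)%type.

Section Trellis.
Variables (n nu : nat).
Implicit Types (e : branch n nu) (p : n.-tuple (branch n nu)).

Definition label e : bool := e.2.
Definition source e : node n nu := (widen_ord (leqnSn n) e.1.1, e.1.2).
Definition target e : node n nu := (lift ord0 e.1.1, next_state e.1.2 e.2).

Definition initial_node : node n nu := (ord0, nseq_tuple nu false).

Fixpoint walk (x : node n nu) (es : seq (branch n nu)) : bool :=
  if es is e :: es' then (source e == x) && walk (target e) es' else true.

Definition trellis_path p : bool := walk initial_node p.

Definition labels p : n.-tuple bool := map_tuple label p.

Definition layer_nodes (i : 'I_n.+1) : {set node n nu} := [set x | x.1 == i].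

End Trellis.

Section Cost.
Variables (R : realType) (n nu : nat) (Q : 'M[R]_n) (r : 'cV[R]_n).

Definition ord_sub (i : 'I_n) (d : nat) : 'I_n :=
  Ordinal (leq_ltn_trans (leq_subr d i) (ltn_ord i)).

(* With i 0-based, min(nu, i - 1) becomes minn nu i and u_(nu - d + 1) becomes
   entry nu - d of the tuple. *)
Definition branch_cost (e : branch n nu) : R :=
  let: (i, u, b) := e in
  alpha Q r i * b%:R
  + \sum_(1 <= d < (minn nu i).+1)
      beta Q r (ord_sub i d) i * (nth false u (nu - d))%:R * b%:R.

Definition path_cost (p : n.-tuple (branch n nu)) : R :=
  \sum_(e <- p) branch_cost e.

Definition enumerates_paths (tie : rel (n.-tuple bool))
    (ps : seq (n.-tuple (branch n nu))) : Prop :=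
  [/\ uniq ps, ps =i @trellis_path n nu
    & ranked path_cost (@labels n nu) tie ps].

End Cost.

(* Main.v *)
(* The state reached at layer i after reading z consists of the last nu bits of
   0^nu z_1 ... z_i, so a trellis path is determined by its label sequence, and
   every word labels exactly one path.  Grouping the quadratic terms of W_r by
   their larger index j and substituting d = j - i, the terms with d > nu vanish
   by bandedness and the others are those of the j-th branch cost; hence path
   cost equals energy.  Both orderings are then sorted enumerations of {0,1}^n
   for the same antisymmetric transitive relation, so they coincide. *)

Require Import Defs.

Set Implicit Arguments.
Unset Strict Implicit.
Unset Printing Implicit Defensive.

Local Open Scope classical_set_scope.
Local Open Scope ring_scope.

(** The padding by [nu] zeros is the initial state, so the layers [i < nu] need no separate case. *)
Definition window nu (z : seq bool) (i : nat) : nu.-tuple bool :=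
  [tuple nth false (nseq nu false ++ z) (i + k) | k < nu].

Lemma nth_window nu z i k : (k < nu)%N ->
  nth false (window nu z i) k = nth false (nseq nu false ++ z) (i + k).
Proof. by move=> ltk; rewrite -(tnth_nth _ _ (Ordinal ltk)) tnth_mktuple. Qed.

Lemma window0 nu z : window nu z 0 = nseq_tuple nu false.
Proof.
apply: eq_from_tnth => k; rewrite tnth_mktuple (tnth_nth false) /= add0n.
by rewrite nth_cat size_nseq ltn_ord.
Qed.

Lemma next_window nu z i :
  next_state (window nu z i) (nth false z i) = window nu z i.+1.
Proof.
apply: eq_from_tnth => k; rewrite tnth_mktuple (tnth_nth false) nth_behead.
rewrite nth_rcons size_tuple; case: (ltngtP k.+1 nu) (ltn_ord k) => // [ltk|eqk] _.
  by rewrite nth_window // addSnnS.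
(* For the last entry, position [i + nu] of the padded word is position [i] of [z]. *)
by rewrite addSnnS eqk nth_cat size_nseq ltnNge leq_addl /= addnK.
Qed.

Section Paths.
Variables (n nu : nat).
Implicit Types (e : branch n nu) (p : n.-tuple (branch n nu)).

Lemma walkP e0 (x : node n nu) (es : seq (branch n nu)) :
  reflect (forall k, (k < size es)%N ->
      source (nth e0 es k) = if k is k'.+1 then target (nth e0 es k') else x)
    (walk x es).
Proof.
elim: es x => [|e es IHes] x /=; first by left.
apply: (iffP andP) => [[/eqP sx /IHes wes] [|[|k]] //= ltk|wes].
- exact: (wes 0%N).
- exact: (wes k.+1).
split; first by apply/eqP; exact: (wes 0%N).
by apply/IHes => -[|k] ltk; [exact: (wes 1%N)|exact: (wes k.+2)].
Qed.

(** Each [target] raises the layer by one and, by [next_window], shifts the window by one, so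
    induction on the position forces every source. *)
Lemma trellis_pathP p :
  reflect (forall i, (tnth p i).1 = (i, window nu (labels p) i))
    (trellis_path p).
Proof.
have labE e0 (i : 'I_n) : (nth e0 p i).2 = nth false (labels p) i.
  by rewrite -!tnth_nth tnth_map.
have sE (i : 'I_n) e : (source e = (widen_ord (leqnSn n) i, window nu (labels p) i))
    <-> e.1 = (i, window nu (labels p) i).
  case: e => -[j u] b; rewrite /source /=; split=> [[eqij ->]|[-> -> //]].
  by congr (_, _); apply: val_inj.
apply: (iffP idP) => [wp i|pE].
  have e0 := tnth p i; have /(walkP e0) := wp; rewrite size_tuple => {}wp.
  apply/sE; case: i => k; elim: k => [|k IHk] ltk; rewrite (tnth_nth e0) wp //=.
    by rewrite window0; congr (_, _); apply: val_inj.
  have := IHk (ltnW ltk); rewrite (tnth_nth e0) => /sE /=.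
  rewrite /target => -> /=; rewrite (labE _ (Ordinal (ltnW ltk))) next_window.
  by congr (_, _); apply: val_inj.
(* A default branch for [nth] is drawn from [p] itself, which requires [n > 0]; the empty path is a
   walk trivially. *)
case: (posnP n) => [n0|lt0n].
  by rewrite /trellis_path; case: (tval p) (size_tuple p) => //; rewrite n0.
have e0 := tnth p (Ordinal lt0n); apply/(walkP e0); rewrite size_tuple => k ltk.
rewrite -(tnth_nth e0 p (Ordinal ltk)); move/sE: (pE (Ordinal ltk)) => -> /=.
case: k ltk => [|k] ltk; first by rewrite window0; congr (_, _); apply: val_inj.
have := pE (Ordinal (ltnW ltk)); rewrite (tnth_nth e0) /target /= => -> /=.
rewrite (labE _ (Ordinal (ltnW ltk))) next_window.
by congr (_, _); apply: val_inj.
Qed.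

Definition path_of (z : n.-tuple bool) : n.-tuple (branch n nu) :=
  [tuple (i, window nu z i, tnth z i) | i < n].

Lemma labels_path_of z : labels (path_of z) = z.
Proof. by apply: eq_from_tnth => i; rewrite tnth_map tnth_mktuple. Qed.

Lemma trellis_path_of z : trellis_path (path_of z).
Proof. by apply/trellis_pathP => i; rewrite labels_path_of tnth_mktuple. Qed.

Lemma path_of_labels p : trellis_path p -> path_of (labels p) = p.
Proof.
move=> /trellis_pathP pE; apply: eq_from_tnth => i.
by rewrite tnth_mktuple -pE tnth_map -surjective_pairing.
Qed.

End Paths.

Arguments path_of [n] nu z.


Lemma sum_lt_ord_sub (V : nmodType) n (F : 'I_n -> V) (j : 'I_n) :
  \sum_(i < n | (i < j)%N) F i = \sum_(1 <= d < j.+1) F (ord_sub j d).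
Proof.
(* Extending [F] by zero to all naturals allows the reversal of the summation index. *)
pose G k := if insub k is Some i then F i else 0.
have GE (i : 'I_n) : G i = F i by rewrite /G valK.
under eq_bigr do rewrite -GE.
rewrite -(big_ord_widen _ G (ltnW (ltn_ord j))) -(big_mkord xpredT G) big_nat_rev.
rewrite big_add1 /= add0n; apply: eq_big_nat => d _.
by rewrite -GE.
Qed.

Lemma path_cost_path_of (R : realType) n nu (Q : 'M[R]_n) (r : 'cV[R]_n) z :
  half_bandwidth_le nu Q -> path_cost Q r (path_of nu z) = energy Q r z.
Proof.
move=> bandQ; rewrite /path_cost big_tuple /energy.
(* The condition moves into the summand so that the two sums can be exchanged; the larger index
   becomes the outer one. *)
rewrite [X in _ = _ + X](eq_bigr (fun i : 'I_n => \sum_(j < n) if (i < j)%N then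
   beta Q r i j * (tnth z i)%:R * (tnth z j)%:R else 0)); last first.
  by move=> i _; rewrite big_mkcond.
rewrite exchange_big -big_split; apply: eq_bigr => i _ /=.
rewrite tnth_mktuple /=; congr (_ + _).
rewrite -big_mkcond sum_lt_ord_sub.
rewrite [RHS](big_cat_nat (n := (minn nu i).+1)) ?ltnS ?geq_minr //=.
rewrite [X in _ = _ + X]big1_seq ?addr0; last first.
  (* Since [d <= i], exceeding [minn nu i] means [d > nu], and the entry of [Q] at distance [d] is
     zero. *)
  move=> d /andP[_]; rewrite mem_index_iota gtn_min => /andP[+ ltdi].
  rewrite [(i < d)%N]ltnNge -(ltnS d) ltdi orbF => ltnud.
  have {}ltdi : (d <= i)%N by [].
  rewrite /beta bandQ ?mulr0 ?mul0r //=.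
  by rewrite subKn // (leq_trans ltnud) ?leq_addl.
apply: eq_big_nat => d /andP[d1]; rewrite ltnS leq_min => /andP[dnu di].
(* Entry [nu - d] of the window is position [i + nu - d] of the padded word. As [d <= i], this lies
   past the padding and is bit [i - d] of [z]. *)
rewrite nth_window; last by rewrite ltn_subrL d1 (leq_trans d1).
rewrite nth_cat size_nseq addnBA // addnC -addnBA // ltnNge leq_addr addKn.
by rewrite !(tnth_nth false).
Qed.

(** Energies decide between classes and [tie] only within one, where it is transitive and
    antisymmetric; so the combined relation has both properties. *)
Lemma ranked_perm_eq (R : realType) n (W : n.-tuple bool -> R) tie zs1 zs2 :
  tie_policy W tie -> ranked W id tie zs1 -> ranked W id tie zs2 ->
  perm_eq zs1 zs2 -> zs1 = zs2.
Proof.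
move=> tieW rk1 rk2.
apply: sorted_eq_in (pairwise_sorted rk1) (pairwise_sorted rk2).
  move=> y x z _ _ _ /orP[ltxy|/andP[/eqP exy txy]] /orP[ltyz|/andP[/eqP eyz tyz]] /=.
  - by rewrite (lt_trans ltxy).
  - by rewrite -eyz ltxy.
  - by rewrite exy ltyz.
  have [_ _ tr _] := tieW (W z).
  by rewrite exy eyz eqxx (tr y) ?orbT // inE ?exy ?eyz.
move=> x y _ _ /andP[/orP[ltxy|/andP[/eqP exy txy]] /orP[ltyx|/andP[/eqP eyx tyx]]].
- by have := lt_trans ltxy ltyx; rewrite ltxx.
- by move: ltxy; rewrite eyx ltxx.
- by move: ltyx; rewrite exy ltxx.
have [_ anti _ _] := tieW (W y).
by apply: anti; rewrite ?inE ?exy // txy.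
Qed.

Lemma map_labels_lpgrand (R : realType) n nu (Q : 'M[R]_n) (r : 'cV[R]_n) tie zs
    (ps : seq (n.-tuple (branch n nu))) :
  half_bandwidth_le nu Q -> tie_policy (energy Q r) tie ->
  lpgrand_order (energy Q r) tie zs -> enumerates_paths Q r tie ps ->
  map (@labels n nu) ps = zs.
Proof.
move=> bandQ tieW [permzs rkzs] [uniqps psE rkps].
have labK : {in ps, cancel (@labels n nu) (@path_of n nu)}.
  by move=> p; rewrite psE => /path_of_labels.
apply: ranked_perm_eq tieW _ rkzs _.
  rewrite /ranked pairwise_map.
  (* Each emitted path is [path_of] its labels, so its cost is the energy of its labels and the
     ranking transfers. *)
  apply: sub_in_pairwise (allss ps) rkps => p q /labK pK /labK qK /=.
  by rewrite -{1 2}pK -{1 2}qK !path_cost_path_of.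
rewrite perm_sym (perm_trans permzs) // uniq_perm ?enum_uniq //.
  by rewrite map_inj_in_uniq //; exact: can_in_inj labK.
move=> z; rewrite mem_enum; apply/esym/mapP; exists (path_of nu z).
  by rewrite psE; exact: trellis_path_of.
by rewrite labels_path_of.
Qed.

Lemma card_node n nu : #|{: node n nu}| = (n.+1 * 2 ^ nu)%N.
Proof. by rewrite card_prod card_ord card_tuple card_bool. Qed.

Lemma card_branch n nu : #|{: branch n nu}| = (n * 2 ^ nu.+1)%N.
Proof. by rewrite !card_prod card_ord card_tuple card_bool -mulnA -expnSr. Qed.

Lemma card_layer_nodes n nu (i : 'I_n.+1) : #|layer_nodes nu i| = (2 ^ nu)%N.
Proof.
have -> : layer_nodes nu i = finset.setX [set i]%SET [set: nu.-tuple bool]%SET.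
  by apply/setP => -[j u]; rewrite !inE andbT.
by rewrite cardsX cards1 cardsT card_tuple card_bool mul1n.
Qed.

Lemma bigTheta_natr (R : realType) (f : nat -> nat) (a b : nat) : (0 < a)%N ->
  (forall n, (0 < n)%N -> (a * n <= f n <= b * n)%N) ->
  (fun n : nat => (f n)%:R : R^o) \is 'Theta_\oo (fun n : nat => n%:R : R^o).
Proof.
(* The bounds at [n = 1] give [a <= f 1 <= b]. *)
move=> a_gt0 fab; have ab : (0 < b)%N.
  by move: (fab 1%N isT); rewrite !muln1 => /andP[/(leq_trans a_gt0) h /(leq_trans h)].
rewrite qualifE; apply/asboolP; exists (a%:R, b%:R) => /=.
  by rewrite !ltr0n a_gt0.
near=> n; have n_gt0 : (0 < n)%N by near: n; exact: nbhs_infty_gt.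
by rewrite /= !normr_nat -!natrM !ler_nat; apply/andP; exact: fab.
Unshelve. all: by end_near. Qed.

Theorem corollaryV3 (R : realType) (nu : nat) :
  [/\ forall (n : nat) (Q : 'M[R]_n) (r : 'cV[R]_n)
        (tie : rel (n.-tuple bool)) (zs : seq (n.-tuple bool))
        (ps : seq (n.-tuple (branch n nu))),
      (nu < n)%N -> posdefmx Q -> half_bandwidth_le nu Q ->
      tie_policy (energy Q r) tie ->
      lpgrand_order (energy Q r) tie zs ->
      enumerates_paths Q r tie ps ->
      forall K : nat, (1 <= K <= 2 ^ n)%N ->
        [seq labels p | p <- take K ps] = take K zs /\
        [seq word_add (hard_decision r) (labels p) | p <- take K ps]
          = take K (candidate_queries r zs),
      forall n : nat, (nu < n)%N ->
        [/\ forall i : 'I_n.+1, (#|layer_nodes nu i| <= 2 ^ nu)%N,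
            (#|{: node n nu}| <= n.+1 * 2 ^ nu)%N
          & (#|{: branch n nu}| <= n * 2 ^ nu.+1)%N],
      (fun n : nat => #|{: node n nu}|%:R : R^o)
        \is 'Theta_\oo (fun n : nat => n%:R : R^o)
    & (fun n : nat => #|{: branch n nu}|%:R : R^o)
        \is 'Theta_\oo (fun n : nat => n%:R : R^o)].
Proof.
split=> [n Q r tie zs ps _ _ bandQ tieW zsW psW K _|n _||].
- rewrite -(map_labels_lpgrand bandQ tieW zsW psW).
  by rewrite /candidate_queries -map_comp !map_take.
- by split=> [i||]; rewrite ?card_layer_nodes ?card_node ?card_branch.
(* The upper constant comes from [n + 1 <= 2 * n] for positive [n]. *)
- apply: (@bigTheta_natr R _ (2 ^ nu) (2 * 2 ^ nu)) => [|n n_gt0].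
    by rewrite expn_gt0.
  rewrite card_node mulnC leq_mul2r leqnSn orbT /= mulnAC leq_mul2r.
  by rewrite mul2n -addnn -[n.+1]add1n leq_add2r n_gt0 orbT.
- apply: (@bigTheta_natr _ _ (2 ^ nu.+1) (2 ^ nu.+1)) => [|n _].
    by rewrite expn_gt0.
  by rewrite card_branch mulnC leqnn.
Qed.
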